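(* Let $G$ be a connected graph of order $n$ and let $k$ be an integer such that $3\leq k\leq n$. Then $\lambda_k(G)=n-\lceil\frac{k}{2}\rceil$ if and only if the following holds: $G=K_n$ if $k$ is even; and $G=K_n\setminus M$ for some edge set $M\subseteq E(K_n)$ with $0\leq |M|\leq \frac{k-1}{2}$ if $k$ is odd.
   Context: All graphs are undirected, finite and simple. For a graph $G$ and a set $S\subseteq V(G)$ of at least two vertices, a tree connecting $S$ is a subgraph $T$ of $G$ that is a tree with $S\subseteq V(T)$. Let $\lambda(S)$ be the maximum number of pairwise edge-disjoint trees connecting $S$ in $G$. The generalized $k$-edge-connectivity of $G$ is $\lambda_k(G)=\min\{\lambda(S) : S\subseteq V(G),\ |S|=k\}$. $K_n$ is the complete graph of order $n$, and $K_n\setminus M$ is the graph obtained from $K_n$ by deleting the edges of $M$ (keeping all vertices). Equality of graphs is understood up to isomorphism. *)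

(* Defs.v *)
From mathcomp Require Import all_boot.

Set Implicit Arguments.
Unset Strict Implicit.
Unset Printing Implicit Defensive.

Record sgraph := SGraph {
  vertex :> finType;
  adj : rel vertex;
  adj_sym : symmetric adj;
  adj_irrefl : irreflexive adj
}.

(* An edge is represented by the set of its two ends. *)
Definition edges (G : sgraph) : {set {set G}} :=
  [set [set xy.1; xy.2] | xy : G * G & adj xy.1 xy.2].

Definition connected (G : sgraph) : Prop :=
  forall x y : G, connect (@adj G) x y.

Definition iso (G H : sgraph) : Prop :=
  exists2 f : G -> H, bijective f & forall x y : G, adj (f x) (f y) = adj x y.

Section Complete.

Variable n : nat.

Definition complete_adj : rel 'I_n := fun x y => x != y.

Lemma complete_adj_sym : symmetric complete_adj.
Proof. by move=> x y; rewrite /complete_adj eq_sym. Qed.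

Lemma complete_adj_irrefl : irreflexive complete_adj.
Proof. by move=> x; rewrite /complete_adj eqxx. Qed.

Definition complete : sgraph := SGraph complete_adj_sym complete_adj_irrefl.

End Complete.

Section DeleteEdges.

Variables (G : sgraph) (M : {set {set G}}).

Definition del_adj : rel G := fun x y => adj x y && ([set x; y] \notin M).

Lemma del_adj_sym : symmetric del_adj.
Proof. by move=> x y; rewrite /del_adj adj_sym setUC. Qed.

Lemma del_adj_irrefl : irreflexive del_adj.
Proof. by move=> x; rewrite /del_adj adj_irrefl. Qed.

Definition del_edges : sgraph := SGraph del_adj_sym del_adj_irrefl.

End DeleteEdges.

Section GeneralizedEdgeConnectivity.

Variable G : sgraph.

(* A vertex set together with an edge set; see [is_subgraph]. *)
Notation subgraph := ({set G} * {set {set G}})%type.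

Definition is_subgraph (T : subgraph) : bool :=
  (T.2 \subset edges G) && [forall A in T.2, A \subset T.1].

Definition sub_adj (T : subgraph) : rel G := fun x y => [set x; y] \in T.2.

(* Since the edges of a subgraph have their ends in T.1, the paths witnessing
   [connect] between distinct vertices stay inside T.1. *)
Definition sub_connected (T : subgraph) : bool :=
  (T.1 != set0) && [forall x in T.1, forall y in T.1, connect (sub_adj T) x y].

(* A cycle has at most #|G| vertices; the bound makes the predicate boolean
   (see [sub_acyclicP]). *)
Definition sub_acyclic (T : subgraph) : bool :=
  [forall m : 'I_#|G|.+1, forall c : m.-tuple G,
     (2 < m) ==> ~~ ucycleb (sub_adj T) c].

Lemma sub_acyclicP (T : subgraph) :
  reflect (forall c : seq G, 2 < size c -> ~ ucycle (sub_adj T) c)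
          (sub_acyclic T).
Proof.
apply: (iffP forallP) => [H c c_gt2 c_cyc | H m].
  have c_lt : size c < #|G|.+1.
    by rewrite ltnS -(card_uniqP (ucycle_uniq c_cyc)) max_card.
  have /forallP/(_ (in_tuple c)) := H (Ordinal c_lt).
  by rewrite /= c_gt2 implyTb => /negP; apply.
apply/forallP=> c; apply/implyP=> m_gt2; apply/negP=> c_cyc.
by apply: (H c) c_cyc; rewrite size_tuple.
Qed.

Definition is_tree (T : subgraph) : bool :=
  [&& is_subgraph T, sub_connected T & sub_acyclic T].

Definition tree_connecting (S : {set G}) (T : subgraph) : bool :=
  is_tree T && (S \subset T.1).

(* Trees connecting at least two vertices have an edge, so edge-disjoint ones
   are distinct and a set of trees loses nothing over an indexed family. *)
Definition tree_packing (S : {set G}) (F : {set subgraph}) : bool :=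
  [forall T in F, tree_connecting S T] &&
  [forall T in F, forall T' in F, (T != T') ==> [disjoint T.2 & T'.2]].

Definition lambda (S : {set G}) : nat :=
  \max_(F : {set subgraph} | tree_packing S F) #|F|.

(* The neutral element is an upper bound of all the [lambda S], so this is the
   minimum as soon as G has a k-subset (see [lambda_k_min]). *)
Definition lambda_k (k : nat) : nat :=
  \big[minn/#|{: subgraph}|]_(S : {set G} | #|S| == k) lambda S.

Lemma lambda_k_le (k : nat) (S : {set G}) : #|S| = k -> lambda_k k <= lambda S.
Proof.
move=> /eqP Sk; rewrite /lambda_k unlock.
elim: (index_enum _) (mem_index_enum S) => //= A r IHr.
rewrite inE => /predU1P[<- | /IHr r_le]; first by rewrite Sk geq_minl.
by case: ifP => // _; rewrite (leq_trans _ r_le) ?geq_minr.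
Qed.

Lemma lambda_k_min (k : nat) :
  k <= #|G| -> exists2 S : {set G}, #|S| = k & lambda_k k = lambda S.
Proof.
move=> k_le.
have [S0 S0k]: exists S : {set G}, #|S| == k.
  have: 0 < #|[set A : {set G} | #|A| == k]|.
    by rewrite card_draws bin_gt0.
  by case/card_gt0P=> A; rewrite inE => Ak; exists A.
have [S /eqP Sk S_min] :=
  @arg_minnP _ S0 (fun A : {set G} => #|A| == k) lambda S0k.
exists S => //; apply/eqP; rewrite eqn_leq lambda_k_le //=.
rewrite /lambda_k; elim/big_ind: _ => [|a b ha hb|A /S_min //].
  by apply/bigmax_leqP=> F _; apply: max_card.
by rewrite leq_min ha.
Qed.

End GeneralizedEdgeConnectivity.

(* Main.v *)
(* A count of the edges meeting a k-set S bounds the number of edge-disjoint trees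
   connecting S: such a tree has at least k of them, or k - 1 when it spans exactly
   S. Equality with n - ceil(k/2) leaves room for no edge missing at S when k is
   even and for (k-1)/2 of them when k is odd; choosing S through ends of missing
   edges turns this into a bound on all missing edges.
   Conversely, every vertex outside S gives a star, missing spokes being bypassed
   through edges inside S, and what remains is a complete graph on S minus at most
   (k-1)/2 edges (none if k is even), which splits into floor(k/2) connected
   spanning subgraphs. For odd k this goes by induction, removing two vertices. *)
Require Import Defs.
From mathcomp Require Import all_boot zify.

Set Implicit Arguments.
Unset Strict Implicit.
Unset Printing Implicit Defensive.

(** * Connectivity by edge sets, and counting parent edges *)

Section Links.

Variable V : finType.
Implicit Types (A S : {set V}) (B : {set V}) (E F : {set {set V}}).

Definition pairs : {set {set V}} := [set B : {set V} | #|B| == 2].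

Definition link E : rel V := fun x y => [set x; y] \in E.

(** The connecting paths may run through vertices outside [S]. *)
Definition joins E S := forall x y, x \in S -> y \in S -> connect (link E) x y.

Lemma link_sym E : symmetric (link E).
Proof. by move=> x y; rewrite /link setUC. Qed.

Lemma connect_link_sym E : connect_sym (link E).
Proof. exact/sym_connect_sym/link_sym. Qed.

Lemma connect_linkS E E' x y :
  E \subset E' -> connect (link E) x y -> connect (link E') x y.
Proof.
move=> /subsetP sEE'; apply: connect_sub => u v uv.
exact/connect1/sEE'.
Qed.

Lemma joins_root E S r :
  (forall x, x \in S -> connect (link E) r x) -> joins E S.
Proof.
move=> Sr x y /Sr rx /Sr ry; apply: connect_trans ry.
by rewrite connect_link_sym.
Qed.

Lemma pair_inj x : injective (fun y : V => [set x; y]).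
Proof.
move=> y z /setP yz; have := yz y; have := yz z; rewrite !inE !eqxx !orbT.
move=> /orP [/eqP zx|/eqP //] /esym/orP [/eqP yx|/eqP //].
by rewrite yx zx.
Qed.

(** [d] is the distance from [r], and [y] the last vertex but one of a shortest path to [x]; it will
    serve as the parent of [x]. *)
Lemma connect_descent E r :
  exists d : V -> nat, forall x, connect (link E) r x -> x != r ->
    exists2 y, link E y x & d y < d x.
Proof.
pose P x n := [exists t : n.-tuple V, path (link E) r t && (last r t == x)].
(* Unreachable vertices satisfy this at 0, so that a minimum exists for every [x]. *)
have exP x : exists n, ~~ connect (link E) r x || P x n.
  case: (boolP (connect _ r x)) => [/connectP [p rp ->]|nrx]; last by exists 0.
  by exists (size p) => /=; apply/existsP; exists (in_tuple p); rewrite rp eqxx.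
exists (fun x => ex_minn (exP x)) => x rx xNr.
case: ex_minnP => m; rewrite rx /= => /existsP [[t /= /eqP st]].
case/andP; elim/last_ind: t st => [|t z _] st /=.
  by move=> _ /eqP rx'; rewrite rx' eqxx in xNr.
rewrite rcons_path last_rcons => /andP [rt tz] /eqP zx _.
exists (last r t); first by rewrite -zx.
case: ex_minnP => m' _ /(_ (size t)); rewrite -st size_rcons; apply.
by apply/orP; right; apply/existsP; exists (in_tuple t); rewrite rt eqxx.
Qed.

(* Every vertex but the root owns the edge towards its parent. *)
Lemma card_linked_edges E S r :
    (forall x, x \in S -> connect (link E) r x) -> r \notin S ->
  #|S| <= #|[set B in E | ~~ [disjoint B & S]]|.
Proof.
move=> Sr rNS; have [d dP] := connect_descent E r.
pose par x := odflt r [pick y | link E y x && (d y < d x)].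
have parP x : x \in S -> link E (par x) x /\ d (par x) < d x.
  move=> xS; rewrite /par; case: pickP => [y /andP[] //|noy].
  have /dP : connect (link E) r x by apply: Sr.
  case=> [|y yx dy]; first by apply: contraNneq rNS => <-.
  by have := noy y; rewrite yx dy.
have inj : {in S &, injective (fun x => [set par x; x])}.
  move=> x y xS yS /setP e; have [_ dx] := parP x xS; have [_ dy] := parP y yS.
  have := e x; have := e y; rewrite !inE !eqxx !orbT.
  move=> /orP [/eqP yp|/eqP //] /esym/orP [/eqP xp|/eqP //].
  by rewrite -yp in dx; rewrite -xp in dy; lia.
rewrite -(card_in_imset inj); apply/subset_leq_card/subsetP => _ /imsetP [x xS ->].
have [lx _] := parP x xS; rewrite inE; apply/andP; split; first exact: lx.
by apply/pred0Pn; exists x; rewrite !inE eqxx orbT xS.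
Qed.

End Links.

(** * From connecting edge sets to edge-disjoint trees *)

Section Trees.

Variable G : sgraph.
Implicit Types (S : {set G}) (E : {set {set G}}).

Lemma in_edges (x y : G) : ([set x; y] \in edges G) = adj x y.
Proof.
apply/imsetP/idP => [[[u v]]|xy]; last by exists (x, y); rewrite ?inE.
rewrite inE /= => uv e; have := set22 x y; have := set21 x y.
rewrite e !inE => /orP [] /eqP ex /orP [] /eqP ey; subst x y.
- by move: uv; have := set22 u v; rewrite -e setUid inE => /eqP ->.
- exact: uv.
- by rewrite adj_sym.
- by move: uv; have := set21 u v; rewrite -e setUid inE => /eqP ->.
Qed.

Lemma edges_pairs : edges G \subset pairs G.
Proof.
apply/subsetP => _ /imsetP [[x y] xy ->]; move: xy; rewrite !inE cards2 /=.
by have [->|] := eqVneq x y; rewrite ?adj_irrefl.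
Qed.

Lemma sub_connectedP (T : {set G} * {set {set G}}) :
  reflect (T.1 != set0 /\ joins T.2 T.1) (sub_connected T).
Proof.
apply: (iffP andP) => -[T0 TP]; split => //.
  by move=> x y xT yT; have /forall_inP/(_ x xT)/forall_inP/(_ y yT) := TP.
by apply/forall_inP => x xT; apply/forall_inP => y yT; apply: TP.
Qed.

(* A cycle survives the removal of one of its edges as a path between the ends
   of that edge. *)
Lemma minset_acyclic (W : {set G}) E :
  minset (fun E' => sub_connected (W, E')) E -> sub_acyclic (W, E).
Proof.
move=> minE; apply/sub_acyclicP => c c_gt2 /andP [cyc uniq_c].
have /sub_connectedP [W0 WE] := minsetp minE.
case: c c_gt2 cyc uniq_c => [|x [|y p]] //= p_gt0 /andP [xy yp].
case/and3P; rewrite inE negb_or => /andP [xNy xNp] yNp up.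
pose D : {set G} := [set x; y].
have yx : connect (link (E :\ D)) y x.
  apply/connectP; exists (rcons p x); last by rewrite last_rcons.
  rewrite rcons_path; have /andP [yp' px] : path (link E) y p && link E (last y p) x.
    by rewrite -rcons_path.
  apply/andP; split.
    apply: (@sub_in_path _ (predC1 x) (link E)) yp'; last first.
      apply/allP => u; rewrite !inE => /predU1P [->|up']; first by rewrite eq_sym.
      by apply: contraNneq xNp => <-.
    move=> u v /= uNx vNx; rewrite /link !inE => ->; rewrite andbT.
    apply/eqP => /setP/(_ x); rewrite !inE eqxx => /=.
    by rewrite ![x == _]eq_sym (negPf uNx) (negPf vNx).
  (* The closing edge from [last y p] to [x] is not [D]: [p] is nonempty and avoids [y]. *)
  rewrite /link !inE setUC; apply/andP; split; last by rewrite setUC.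
  apply/eqP => /pair_inj e; move: yNp; rewrite -e.
  by case: (p) p_gt0 => //= z q _; rewrite mem_last.
have : E :\ D = E.
  apply: (minsetinf minE); last exact: subD1set.
  apply/sub_connectedP; split=> //= u v uW vW; have /= := WE u v uW vW.
  apply: connect_sub => {uW vW} {}u {}v uv.
  have [e|uvND] := eqVneq [set u; v] D; last first.
    by apply: connect1; rewrite /link !inE uvND.
  have := set22 u v; have := set21 u v; rewrite e !inE.
  by case/orP => /eqP -> /orP [] /eqP -> //; rewrite connect_link_sym.
by move/setP/(_ D); rewrite !inE eqxx /= => /esym; rewrite /D -/(link E x y) => /negP.
Qed.

(** The component [W] of a vertex of [S] contains [S], and a minimal set of edges of [E] that still
    connects [W] has no cycle. *)
Lemma exists_tree_connecting S E :
    E \subset edges G -> S != set0 -> joins E S ->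
  exists2 T : {set G} * {set {set G}}, tree_connecting S T & T.2 \subset E.
Proof.
move=> /subsetP sEG /set0Pn [s sS] ES.
pose W := [set x | connect (link E) s x].
pose E0 := [set B in E | B \subset W].
have conE0 : sub_connected (W, E0).
  apply/sub_connectedP; split; first by apply/set0Pn; exists s; rewrite inE.
  apply: (@joins_root _ _ _ s) => x; rewrite inE /= => /connectP [p sp ->].
  elim/last_ind: p sp => [|p y IH]; first by move=> _; exact: connect0.
  rewrite rcons_path last_rcons => /andP [sp py].
  apply: connect_trans (IH sp) (connect1 _); rewrite /link inE.
  apply/andP; split; first exact: py.
  have sl : connect (link E) s (last s p) by apply/connectP; exists p.
  apply/subsetP => z; rewrite !inE => /orP [] /eqP -> //.
  exact: connect_trans sl (connect1 py).
have [E' minE' sE'] :=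
  minset_exists (P := fun E' => sub_connected (W, E')) conE0.
have {}sE' B : B \in E' -> (B \in E) && (B \subset W).
  by move/(subsetP sE'); rewrite inE.
exists (W, E'); last by apply/subsetP => B /sE' /andP [].
apply/andP; split; last by apply/subsetP => x xS; rewrite inE ES.
apply/and3P; split; first 1 last.
- exact: minsetp minE'.
- exact: minset_acyclic minE'.
apply/andP; split; first by apply/subsetP => B /sE' /andP [/sEG].
by apply/forall_inP => B /sE' /andP [].
Qed.

(* Edges of different colours are different, so a colouring with m connected
   classes yields m edge-disjoint trees. *)
Lemma colour_packing S (m : nat) (c : {set G} -> nat) :
    1 < #|S| ->
    (forall i, i < m -> joins [set B in edges G | c B == i] S) ->
  m <= lambda S.
Proof.
move=> S_gt1 cS; have S0 : S != set0 by rewrite -card_gt0; lia.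
have exT (i : 'I_m) : exists T : {set G} * {set {set G}},
    tree_connecting S T && (T.2 \subset [set B in edges G | c B == i]).
  have [|T ST sT] := exists_tree_connecting _ S0 (cS i (ltn_ord i)).
    by apply/subsetP => B; rewrite inE => /andP [].
  by exists T; rewrite ST.
have [t tP] := fin_all_exists exT.
have colt i B : B \in (t i).2 -> c B = i.
  by case/andP: (tP i) => _ /subsetP sT /sT; rewrite inE => /andP [_ /eqP].
(* Each tree has an edge, whose colour recovers the index; hence [t] is injective. *)
have t0 i : exists B, B \in (t i).2.
  have [x [y [xS yS xNy]]] := card_gt1P S_gt1.
  case/andP: (tP i) => /andP [/and3P [_ /sub_connectedP [_ con] _] /subsetP sS] _.
  have /connectP [[/= _ e|z p /= /andP [xz _] _]] := con _ _ (sS x xS) (sS y yS).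
    by rewrite e eqxx in xNy.
  by exists [set x; z].
have injt : injective t.
  move=> i j e; have [B Bi] := t0 i; apply/val_inj.
  by rewrite /= -(colt i B Bi); apply: colt; rewrite -e.
have <- : #|t @: setT| = m by rewrite card_imset // cardsT card_ord.
apply: (@leq_bigmax_cond _ (tree_packing S) (fun F => #|F|)).
apply/andP; split.
  by apply/forall_inP => _ /imsetP [i _ ->]; case/andP: (tP i).
apply/forall_inP => _ /imsetP [i _ ->].
apply/forall_inP => _ /imsetP [j _ ->]; apply/implyP => ij.
apply/pred0P => B /=; apply/negP => /andP [/colt Bi /colt Bj].
by case/eqP: ij; congr t; apply/val_inj; rewrite /= -Bi.
Qed.

End Trees.

(** * Upper bound on [lambda] by counting the edges that meet [S] *)

Lemma sum_card_disjoint (I T : finType) (J : {set I}) (f : I -> {set T})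
    (D : {set T}) :
    (forall i, i \in J -> f i \subset D) ->
    {in J &, forall i j, i != j -> [disjoint f i & f j]} ->
  \sum_(i in J) #|f i| <= #|D|.
Proof.
(* Padding with [set0] makes the family disjoint over the whole index type. *)
move=> fD dis; pose g i := if i \in J then f i else set0.
have gdis i j : i != j -> [disjoint g i & g j].
  rewrite /g; case: ifP => iJ; last by rewrite -setI_eq0 set0I.
  by case: ifP => jJ; [exact: dis | rewrite -setI_eq0 setI0].
have -> : \sum_(i in J) #|f i| = \sum_(x in \bigcup_i g i) 1.
  rewrite partition_disjoint_bigcup // big_mkcond /=; apply: eq_bigr => i _.
  by rewrite /g sum1_card; case: ifP => // _; rewrite cards0.
rewrite sum1_card; apply/subset_leq_card/bigcupsP => i _.
by rewrite /g; case: ifP => [/fD //|_]; rewrite sub0set.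
Qed.

Lemma bin2D k m : 'C(k + m, 2) = 'C(k, 2) + 'C(m, 2) + k * m.
Proof. elim: k => [|k IH]; first by rewrite add0n bin0n mul0n addn0.
by rewrite addSn !binS !bin1 IH; lia. Qed.

Section UpperBound.

Variable G : sgraph.
Implicit Types (S B : {set G}) (T : {set G} * {set {set G}}).

Definition nonedges : {set {set G}} := pairs G :\: edges G.

Definition touching S (E : {set {set G}}) := [set B in E | ~~ [disjoint B & S]].

(** All pairs are counted, less those inside the complement of [S]. *)
Lemma card_touching_pairs S :
  #|touching S (pairs G)| = #|S| * (#|G| - #|S|) + 'C(#|S|, 2).
Proof.
have -> : touching S (pairs G) =
    pairs G :\: [set B : {set G} | B \subset ~: S & #|B| == 2].
  apply/setP => B; rewrite !inE; case: (#|B| == 2); rewrite /= ?andbF ?andbT //.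
  by rewrite disjoints_subset.
rewrite cardsDS; last by apply/subsetP => B; rewrite !inE => /andP [].
rewrite cards_draws card_draws cardsCs setCK.
by have /subnKC {1}<- := max_card S; rewrite bin2D addnAC addnK addnC.
Qed.

(* A tree with a vertex r outside S is rooted at r, so that each of the k
   vertices of S owns a parent edge; a tree spanning exactly S only has k - 1
   edges, but all of them are pairs of elements of S, so there are at most k / 2
   such trees. *)
Lemma tree_packing_bound S F :
    1 < #|S| -> tree_packing S F ->
  #|S| * #|F| + #|touching S nonedges|
    <= #|S| * (#|G| - #|S|) + 'C(#|S|, 2) + #|S|./2.
Proof.
move=> S_gt1 /andP [/forall_inP Ftree /forall_inP Fdis].
have {}Fdis : {in F &, forall T T', T != T' -> [disjoint T.2 & T'.2]}.
  by move=> T T' TF T'F; move/forall_inP/(_ T' T'F)/implyP: (Fdis T TF).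
have sub_touching T : touching S T.2 \subset T.2.
  by apply/subsetP => B; rewrite inE => /andP [].
have touch_dis : {in F &, forall T T', T != T' ->
    [disjoint touching S T.2 & touching S T'.2]}.
  move=> T T' TF T'F TT'.
  by apply: disjointWl (sub_touching T) (disjointWr (sub_touching T') _); exact: Fdis.
have con T r : T \in F -> r \in T.1 -> forall x, x \in S -> connect (link T.2) r x.
  move=> /Ftree /andP [/and3P [_ /sub_connectedP [_ TT] _] /subsetP sS] rT x xS.
  by apply: TT => //; exact: sS.
have TG T : T \in F -> T.2 \subset edges G.
  by move=> /Ftree /andP [/and3P [/andP [] ]].
pose F1 := [set T in F | T.1 == S].
have touch_ge T : T \in F -> #|S| <= #|touching S T.2| + (T.1 == S).
  move=> TF; have [TS|TNS] := eqVneq T.1 S.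
    have /card_gt0P [r rS] : 0 < #|S| by lia.
    have rT : r \in T.1 by rewrite TS.
    (* The root lies in [S] here and owns no edge; the summand [T.1 == S] makes up for it. *)
    rewrite (cardsD1 r S) rS addnC leq_add2r.
    apply: (@leq_trans #|touching (S :\ r) T.2|).
      apply: (@card_linked_edges _ _ _ r); last by rewrite !inE eqxx.
      by move=> x; rewrite inE => /andP [_]; apply: con.
    apply/subset_leq_card/subsetP => B; rewrite !inE => /andP [-> /=].
    by apply: contra; apply: disjointWr; exact: subD1set.
  rewrite addn0; have [_ sS] := andP (Ftree T TF).
  have /subsetPn [r rT rNS] : ~~ (T.1 \subset S).
    by apply: contra TNS => sT; rewrite eqEsubset sT.
  by apply: (@card_linked_edges _ _ _ r) => //; exact: con.
have card_F1 : #|F1| <= #|S|./2.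
  have : \sum_(T in F1) #|touching S T.2| <= 'C(#|S|, 2).
    rewrite -cards_draws; apply: sum_card_disjoint; last first.
      by move=> T T'; rewrite !inE => /andP [TF _] /andP [T'F _]; apply: touch_dis.
    move=> T; rewrite inE => /andP [TF /eqP TS]; apply/subsetP => B.
    rewrite !inE => /andP [BT _].
    have := subsetP (edges_pairs G) B (subsetP (TG T TF) B BT).
    rewrite inE => ->; rewrite andbT -TS.
    by have /andP [/and3P [/andP [_ /forall_inP sT] _ _] _] := Ftree T TF; exact: sT.
  have : \sum_(T in F1) (#|S|.-1) <= \sum_(T in F1) #|touching S T.2|.
    apply: leq_sum => T; rewrite inE => /andP [/touch_ge TS TS1].
    by move: TS; rewrite TS1 addn1; case: #|S|.
  rewrite sum_nat_const => h1 h2; move: (leq_trans h1 h2).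
  rewrite bin2 => h; have {}h : #|F1| * #|S|.-1 * 2 <= #|S| * #|S|.-1 by lia.
  move: h; rewrite -mulnAC leq_pmul2r; lia.
have card_F : #|S| * #|F| <= #|touching S (edges G)| + #|F1|.
  have : \sum_(T in F) #|S| <= \sum_(T in F) (#|touching S T.2| + (T.1 == S)).
    by apply: leq_sum => T /touch_ge.
  rewrite sum_nat_const big_split /= mulnC => h; apply: leq_trans h _.
  apply: leq_add; last first.
    by rewrite -sum1dep_card big_mkcondr /=; apply: leq_sum => T _; case: ifP.
  apply: sum_card_disjoint touch_dis => T /TG sT.
  by apply/subsetP => B; rewrite !inE => /andP [/(subsetP sT) -> ->].
have : #|touching S (edges G)| + #|touching S nonedges| = #|touching S (pairs G)|.
  rewrite -(cardsID (edges G) (touching S (pairs G))); congr (_ + _).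
    apply: eq_card => B; rewrite !inE; have := subsetP (edges_pairs G) B.
    by rewrite inE; case: (B \in edges G) => [->|_]; rewrite ?andbF ?andbT.
  by apply: eq_card => B; rewrite !inE andbA.
by rewrite card_touching_pairs; lia.
Qed.

(** This is division by [k]: ['C(k, 2) + k./2] has quotient [k./2] and remainder [odd k * k./2], and
    when [f] attains its bound only the remainder is left for [t]. *)
Lemma packing_bound_arith k m f t :
    0 < k -> k * f + t <= k * m + 'C(k, 2) + k./2 ->
  f <= m + k./2 /\ (f = m + k./2 -> t <= odd k * k./2).
Proof.
move=> k_gt0 h; set p := k./2 in h *.
have e : 'C(k, 2) + p = k * p + odd k * p.
  by have := odd_double_half k; rewrite -/p bin2; case: (odd k) => /= <-; nia.
have op : odd k * p < k by rewrite /p; case: (odd k); lia.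
by split=> [|fe]; nia.
Qed.

Lemma lambda_bound S :
    1 < #|S| ->
  lambda S <= #|G| - uphalf #|S| /\
  (lambda S = #|G| - uphalf #|S| ->
   #|touching S nonedges| <= odd #|S| * #|S|./2).
Proof.
move=> S_gt1; have [F FS ->] : exists2 F, tree_packing S F & lambda S = #|F|.
  have : 0 < #|tree_packing S|.
    apply/card_gt0P; exists set0; apply/andP.
    by split; apply/forall_inP => T; rewrite inE.
  by case/(eq_bigmax_cond (fun F : {set _} => #|F|)) => F; exists F.
have -> : #|G| - uphalf #|S| = #|G| - #|S| + #|S|./2.
  by have := max_card S; lia.
by apply: packing_bound_arith; [lia | apply: tree_packing_bound].
Qed.

End UpperBound.

(** * Splitting an almost complete graph into connected spanning subgraphs *)

Section CompletePacking.

Variable V : finType.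
Implicit Types (A S X Y B : {set V}) (E F : {set {set V}}) (c : {set V} -> nat).

Definition pairs_in A := [set B in pairs V | B \subset A].

(** [F] holds the edges withheld from the complete graph on [A]; as classes of one colouring, the
    subgraphs are edge-disjoint by construction. *)
Definition colour_class A F c i := [set B in pairs_in A :\: F | c B == i].

Lemma pairs_inE A B : (B \in pairs_in A) = (#|B| == 2) && (B \subset A).
Proof. by rewrite !inE. Qed.

Lemma in_pairs_in A x y :
  ([set x; y] \in pairs_in A) = [&& x != y, x \in A & y \in A].
Proof. by rewrite !inE cards2 subUset !sub1set; case: (x != y). Qed.

Lemma in_colour_class A F c i B :
  (B \in colour_class A F c i) = [&& B \in pairs_in A, B \notin F & c B == i].
Proof. by rewrite inE in_setD -andbA andbCA. Qed.

Lemma card_cover_pairs F : F \subset pairs V -> #|cover F| <= 2 * #|F|.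
Proof.
move=> /subsetP sF; rewrite mulnC -sum_nat_const.
apply: leq_trans (leq_card_cover F).1 _; apply: leq_sum => B /sF.
by rewrite inE => /eqP ->.
Qed.

Lemma in_cover F B x : B \in F -> x \in B -> x \in cover F.
Proof. by move=> BF xB; apply/bigcupP; exists B. Qed.

Lemma joins_setU1 E A a x :
  joins E A -> x \in A -> [set a; x] \in E -> joins E (a |: A).
Proof.
move=> EA xA ax; apply: (@joins_root _ _ _ x) => y /setU1P [->|yA]; last exact: EA.
by apply: connect1; rewrite link_sym.
Qed.

Lemma joinsS E E' A : E \subset E' -> joins E A -> joins E' A.
Proof. by move=> sE EA x y xA yA; apply: connect_linkS sE _; apply: EA. Qed.

(** This computes the colour of an edge at [a]: the position of its other end in [X], or [#|X|], the
    last colour, if that end is outside [X]. *)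
Lemma find_pair a x X :
  a \notin X -> find (mem [set a; x]) (enum X) = index x (enum X).
Proof.
move=> aX; apply: eq_in_find => y; rewrite mem_enum => yX.
by rewrite !inE; case: eqP => // ya; rewrite -ya yX in aX.
Qed.

Lemma index_enum_out x X : x \notin X -> index x (enum X) = #|X|.
Proof. by move=> xX; rewrite memNindex ?mem_enum // -cardE. Qed.

Lemma index_enum_onto X i :
  i < #|X| -> exists2 x, x \in X & index x (enum X) = i.
Proof.
move=> iX; have /card_gt0P [x0 _] : 0 < #|X| by lia.
exists (nth x0 (enum X) i); first by rewrite -mem_enum mem_nth // -cardE.
by rewrite index_uniq ?enum_uniq // -cardE.
Qed.

Lemma exists_subset_between A B m :
    A \subset B -> #|A| <= m <= #|B| ->
  exists C : {set V}, [/\ A \subset C, C \subset B & #|C| = m].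
Proof.
move=> sAB /andP []; elim: m => [|m IH] Am mB.
  exists A; split=> //; apply/eqP; lia.
have [Am'|mA] := leqP #|A| m; last by exists A; split=> //; lia.
have [|C [AC CB Cm]] := IH Am'; first lia.
have /subsetPn [x xB xC] : ~~ (B \subset C).
  by apply: contraL mB => /subset_leq_card; lia.
exists (x |: C); split; last by rewrite cardsU1 xC Cm.
- exact: subset_trans AC (subsetUr _ _).
- by rewrite subUset sub1set xB.
Qed.

Lemma card_avoid_neighbours F a :
  #|[set B in F | a \notin B]| + #|[set x | [set a; x] \in F]| <= #|F|.
Proof.
rewrite -(card_imset _ (@pair_inj _ a)) -(cardsID [set B in F | a \notin B] F).
rewrite leq_add //.
  by apply/subset_leq_card/subsetP => C; rewrite !inE => /andP [-> ->].
apply/subset_leq_card/subsetP => _ /imsetP [x xF ->].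
by move: xF; rewrite !inE eqxx andbF => ->.
Qed.

(* In the graph F, the vertex b is isolated and a is not (unless F is empty); if
   a has degree d, then at least d vertices are isolated, hence w when d > 1. *)
Lemma odd_packing_choice q A F :
    #|A| = q.+1.*2.+1 -> F \subset pairs_in A -> #|F| <= q.+1 ->
  exists a b z : V,
    [/\ a \in A, b \in A :\ a, z \in A :\ a :\ b, b \notin cover F &
        [\/ F = set0,
            [set a; z] \in F /\ [set x | [set a; x] \in F] = [set z] |
            [set a; z] \in F /\ exists2 w, w \in A :\ a :\ b & w \notin cover F]].
Proof.
move=> cA /subsetP sF cF; have [F0|[B BF]] := set_0Vmem F.
  have /card_gt0P [a aA] : 0 < #|A| by lia.
  have cA1 : #|A :\ a| = q.+1.*2 by have := cardsD1 a A; rewrite aA; lia.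
  have /card_gt0P [b bA] : 0 < #|A :\ a| by lia.
  have /card_gt0P [z zA] : 0 < #|A :\ a :\ b|.
    by have := cardsD1 b (A :\ a); rewrite bA; lia.
  exists a, b, z; split=> //; last by constructor 1.
  by rewrite F0 /cover big_set0 inE.
have := sF B BF; rewrite !inE => /andP [/cards2P [a [z [aNz eB]]]].
rewrite {}eB in BF *; rewrite subUset !sub1set => /andP [aA zA].
pose N := [set x | [set a; x] \in F]; pose F' := [set B in F | a \notin B].
have zN : z \in N by rewrite inE.
have cFN : #|F'| + #|N| <= #|F| by apply: card_avoid_neighbours.
have sP : {subset F <= pairs V} by move=> C /sF; rewrite inE => /andP [].
have cF' : #|cover F'| <= 2 * #|F'|.
  by apply/card_cover_pairs/subsetP => C; rewrite inE => /andP [/sP].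
have cD : #|cover F| <= #|N|.+1 + #|cover F'|.
  apply: (@leq_trans #|(a |: N) :|: cover F'|); last first.
    rewrite (leq_trans (leq_card_setU _ _).1) // leq_add2r cardsU1.
    by case: (a \notin N).
  apply/subset_leq_card/subsetP => x /bigcupP [C CF xC]; rewrite !inE.
  have [aC|aC] := boolP (a \in C); last first.
    by apply/orP; right; apply: in_cover xC; rewrite inE CF.
  have [//|xNa] := eqVneq x a; suff -> : [set a; x] = C by rewrite CF.
  apply/eqP; rewrite eqEcard subUset !sub1set aC xC /= cards2 eq_sym xNa.
  by have := sP _ CF; rewrite inE => /eqP ->.
(* With [d = #|N|], [F] covers at most [d + 1 + 2 * (q + 1 - d)] of the [2 * q + 3] vertices of [A],
   which leaves [d] of them. *)
have cAD : #|N| <= #|A :\: cover F|.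
  by have := cardsD A (cover F); have := subset_leq_card (subsetIr A (cover F)); lia.
have N_gt0 : 0 < #|N| by apply/card_gt0P; exists z.
have aD : a \in cover F by apply: in_cover BF _; rewrite set21.
have zD : z \in cover F by apply: in_cover BF _; rewrite set22.
have /card_gt0P [b bAD] : 0 < #|A :\: cover F| by lia.
have /andP [bD bA] : (b \notin cover F) && (b \in A) by move: bAD; rewrite inE.
have bNa : b != a by apply: contraNneq bD => ->.
have zNb : z != b by apply: contraNneq bD => <-.
exists a, b, z; split=> //; rewrite ?inE ?bNa ?zNb ?(eq_sym z) ?aNz //.
have [N1|N_gt1] := leqP #|N| 1.
  constructor 2; split=> //; apply/esym/eqP.
  by rewrite -/N eqEcard sub1set zN cards1.
constructor 3; split=> //.
have /card_gt0P [w] : 0 < #|(A :\: cover F) :\ b|.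
  by move: (leq_trans N_gt1 cAD); rewrite (cardsD1 b) bAD.
rewrite !inE => /and3P [wNb wD wA]; exists w => //.
by rewrite !inE wNb wA andbT; apply: contraNneq wD => ->.
Qed.


(* The q inductive subgraphs on A' = A minus {a, b} are extended by edges from a to
   X and from b to Y, where X, Y and {z} partition A'. The last subgraph consists
   of all other edges at a or b outside F. The vertices of Y it misses are
   neighbours of a in F other than z; they are joined to w by edges L, which are
   withheld from the inductive subgraphs in place of the edges of F at a. *)
Lemma odd_packing q A F :
    #|A| = q.*2.+1 -> F \subset pairs_in A -> #|F| <= q ->
  exists c, forall i, i < q -> joins (colour_class A F c i) A.
Proof.
elim: q A F => [|q IH] A F cA sF cF; first by exists (fun=> 0).
have [a [b [z [aA]]]] := odd_packing_choice cA sF cF.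
set A' := A :\ a :\ b => bA zA' bD choice.
move/subsetP: sF => sF; have cA' : #|A'| = q.*2.+1.
  by have := cardsD1 b (A :\ a); have := cardsD1 a A; rewrite -/A' bA aA cA; lia.
have [bNa bA0] : b != a /\ b \in A by apply/andP; rewrite -in_setD1.
have aA' : a \notin A' by rewrite !inE eqxx andbF.
have bA' : b \notin A' by rewrite !inE eqxx.
have eA : A = a |: (b |: A') by rewrite !setD1K.
pose N := [set x | [set a; x] \in F]; pose M := N :\ z.
have NA' x : x \in N -> x \in A'.
  rewrite !inE => ax; move: (sF _ ax); rewrite in_pairs_in eq_sym => /and3P [-> _ ->].
  rewrite !andbT; apply: contraNneq bD => <-.
  by apply: in_cover ax _; rewrite set22.
have sMA' : M \subset A' :\ z by apply: setSD; apply/subsetP.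
have cFN : #|[set B in F | a \notin B]| + #|N| <= #|F|.
  exact: card_avoid_neighbours.
(* The budget for the induction is [q]: unless [F] is empty, the edge from [a] to [z] is in [F] but
   needs no replacement in [L]. *)
have cM : #|[set B in F | a \notin B]| + #|M| <= q.
  have [F0|az] : F = set0 \/ [set a; z] \in F.
    by case: choice => [F0|[az _]|[az _]]; [left | right | right].
    apply: leq_trans (leq0n q); rewrite -(cards0 {set V}) -F0 (leq_trans _ cFN) //.
    by rewrite leq_add2l subset_leq_card ?subD1set.
  have zN : z \in N by rewrite inE.
  rewrite -ltnS (leq_trans _ cF) // (leq_trans _ cFN) // -addnS leq_add2l.
  by rewrite [#|N|](cardsD1 z) zN.
(* In the first two cases [M] is empty, and [a] is a mere placeholder for [w]. *)
have [w wP] : exists w, M != set0 -> w \in A' /\ w \notin cover F.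
  case: choice => [F0|[_ Nz]|[_ [w wA wD]]]; last by exists w.
    by exists a => /set0Pn [x]; rewrite !inE F0 inE andbF.
  by exists a => /set0Pn [x]; rewrite /M /N Nz setDv inE.
have MP y : y \in M -> [/\ y \in A', y \in cover F, w \in A' & w \notin cover F].
  move=> yM; have [|wA wD] := wP; first by apply/set0Pn; exists y.
  have yN : y \in N by move: yM; rewrite inE => /andP [].
  split=> //; first exact: NA'.
  by apply: (@in_cover _ [set a; y]); [rewrite inE in yN | rewrite set22].
have cA'z : #|A' :\ z| = q.*2 by move: (cardsD1 z A'); rewrite zA' cA' => -[].
(* Since [Y] contains [M] and [X] leaves out [z], no vertex of [X] is a neighbour of [a] in [F]. *)
have [|Y [MY YA' cY]] := exists_subset_between (m := q) sMA'.
  by rewrite cA'z (leq_trans (leq_addl _ _) cM) -addnn leq_addr.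
pose X := A' :\ z :\: Y; have cX : #|X| = q by rewrite /X cardsDS // cA'z cY -addnn addnK.
pose L := [set [set w; y] | y in M].
pose F' := [set B in F | a \notin B] :|: L.
have [||c' c'P] := IH A' F' cA'.
- apply/subsetP => B /setUP [|/imsetP [y /MP [yA yD wA wD] ->]]; last first.
    by rewrite in_pairs_in yA wA andbT andbT; apply: contraNneq wD => ->.
  rewrite inE => /andP [BF aB]; move: (sF B BF); rewrite !inE => /andP [-> BA].
  rewrite !subsetD1 BA aB /=; apply: contra bD; exact: in_cover BF.
- apply: leq_trans (leq_card_setU _ _).1 (leq_trans _ cM).
  by rewrite leq_add2l leq_imset_card.
(* Each colour below [q] gets one edge from [a] to [X] and one from [b] to [Y]; all other edges at
   [a] or [b] get [q], the common size of [X] and [Y]. *)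
pose c B := if a \in B then find (mem B) (enum X) else
            if b \in B then find (mem B) (enum Y) else
            if B \in L then q else c' B.
have sXA' : {subset X <= A'} by move=> x; rewrite !inE => /and3P [_ _].
have sYA' : {subset Y <= A'} by move=> x /(subsetP YA'); rewrite inE => /andP [].
have aX : a \notin X by apply: contra aA' => /sXA'.
have bX : b \notin X by apply: contra bA' => /sXA'.
have bY : b \notin Y by apply: contra bA' => /sYA'.
have neq x y : x \in A' -> y \notin A' -> y != x.
  by move=> xA yA; apply: contraNneq yA => ->.
have sA'A : {subset A' <= A} by move=> x; rewrite !inE => /and3P [].
have bF x : [set b; x] \notin F.
  by apply: contra bD => bx; apply: in_cover bx _; rewrite set21.
have ca x : c [set a; x] = index x (enum X) by rewrite /c set21 find_pair.
have cb x : x \in A' -> c [set b; x] = index x (enum Y).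
  move=> xA; rewrite /c ifN ?set21 ?find_pair //.
  by rewrite !inE negb_or eq_sym bNa neq.
have class_a i x : x \in A' -> x \notin N ->
    ([set a; x] \in colour_class A F c i) = (index x (enum X) == i).
  move=> xA xN; rewrite in_colour_class in_pairs_in ca neq // aA sA'A //=.
  by move: xN; rewrite inE => ->.
have class_b i x : x \in A' ->
    ([set b; x] \in colour_class A F c i) = (index x (enum Y) == i).
  by move=> xA; rewrite in_colour_class in_pairs_in cb // neq // bA0 sA'A // bF.
exists c => i; rewrite ltnS leq_eqVlt => /predU1P [->|iq]; last first.
  have cls : colour_class A' F' c' i \subset colour_class A F c i.
    apply/subsetP => B; rewrite !in_colour_class => /and3P [].
    rewrite !pairs_inE => /andP [B2 BA] BF' cB.
    have aB : a \notin B by apply: contra aA'; apply: (subsetP BA).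
    have bB : b \notin B by apply: contra bA'; apply: (subsetP BA).
    move: BF'; rewrite !inE aB andbT negb_or => /andP [BF BL].
    rewrite BF B2 /c (negPf aB) (negPf bB) (negPf BL) cB andbT /=.
    by rewrite (subset_trans BA) //; apply/subsetP.
  have [|x xX xi] := @index_enum_onto X i; first by rewrite cX.
  have [|y yY yi] := @index_enum_onto Y i; first by rewrite cY.
  rewrite {2}eA; apply: (@joins_setU1 _ _ _ x).
  - apply: (@joins_setU1 _ _ _ y); first exact: joinsS cls (c'P i iq).
      exact: sYA'.
    by rewrite class_b ?yi ?sYA'.
  - by rewrite inE sXA' ?orbT.
  - rewrite class_a ?xi ?sXA' //; move: xX; rewrite !inE => /and3P [xY xz _].
    by apply: contra xY => xN; apply: (subsetP MY); rewrite !inE xz.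
(* In colour [q], [b] reaches [a] and the vertices outside [Y] by an edge, those of [Y] outside [M]
   through [a], and those of [M] through [w]. *)
have ba : connect (link (colour_class A F c q)) b a.
  apply: connect1; rewrite link_sym /link in_colour_class ca index_enum_out // cX eqxx.
  by rewrite setUC bF in_pairs_in bNa aA bA0.
have reach x : x \in A' -> x \notin M -> connect (link (colour_class A F c q)) b x.
  move=> xA xM; have [xY|xY] := boolP (x \in Y); last first.
    by apply: connect1; rewrite /link class_b // index_enum_out // cY.
  apply: connect_trans ba (connect1 _); rewrite /link class_a //.
    by rewrite index_enum_out ?cX // inE xY.
  move: xM; rewrite in_setD1 negb_and negbK => /orP [/eqP xz|//].
  by move: (subsetP YA' x xY); rewrite xz !inE eqxx.
rewrite {2}eA; apply: (@joins_root _ _ _ b) => x /setU1P [->//|/setU1P [->//|xA]].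
have [xM|] := boolP (x \in M); last exact: reach.
have [_ xD wA wD] := MP x xM.
apply: connect_trans (reach w wA _) (connect1 _).
  by apply: contra wD => /MP [].
rewrite /link in_colour_class in_pairs_in !sA'A //.
have wx : w != x by apply: contraNneq wD => ->.
have -> : [set w; x] \notin F.
  by apply: contra wD => wx'; apply: in_cover wx' _; rewrite set21.
have wxL : [set w; x] \in L by apply: imset_f.
by rewrite wx /c wxL !ifN ?eqxx // !inE negb_or !neq.
Qed.

(* A vertex z is added to an odd packing avoiding a star F with centre w; the last
   subgraph consists of F and the edges from z to the vertices other than its
   leaves Y. *)
Lemma even_packing p A :
    #|A| = p.+1.*2 ->
  exists c, forall i, i < p.+1 -> joins (colour_class A set0 c i) A.
Proof.
move=> cA; have /card_gt0P [z zA] : 0 < #|A| by lia.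
pose A' := A :\ z; have cA' : #|A'| = p.*2.+1.
  by have := cardsD1 z A; rewrite zA cA /A'; lia.
have /card_gt0P [w wA'] : 0 < #|A'| by lia.
have cA'w : #|A' :\ w| = p.*2 by have := cardsD1 w A'; rewrite wA' cA'; lia.
(* The size [p] gives one edge from [z] to each of the [p] inductive colours, and is the most that
   [odd_packing] allows to withhold. *)
have [||Y [_ YA' cY]] := @exists_subset_between set0 (A' :\ w) p.
- exact: sub0set.
- by rewrite cards0 cA'w; lia.
have zA' : z \notin A' by rewrite !inE eqxx.
have YP y : y \in Y -> y != w /\ y \in A'.
  by move/(subsetP YA'); rewrite in_setD1 => /andP.
have wY : w \notin Y by apply/negP => /YP []; rewrite eqxx.
have zY : z \notin Y by apply: contra zA' => /YP [].
pose F := [set [set w; y] | y in Y].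
have sA'A : {subset A' <= A} by move=> x; rewrite inE => /andP [].
have eA : A = z |: A' by rewrite setD1K.
have [||c' c'P] := @odd_packing p A' F cA'.
- apply/subsetP => _ /imsetP [y /YP [yw yA] ->].
  by rewrite in_pairs_in eq_sym yw wA'.
- by rewrite -cY leq_imset_card.
pose c B := if z \in B then find (mem B) (enum Y) else if B \in F then p else c' B.
have class_z i x : x \in A' ->
    ([set z; x] \in colour_class A set0 c i) = (index x (enum Y) == i).
  move=> xA; rewrite in_colour_class in_pairs_in inE zA sA'A //= /c set21 find_pair //.
  by rewrite andbT; case: eqP => // zx; rewrite zx xA in zA'.
exists c => i; rewrite ltnS leq_eqVlt => /predU1P [->|ip]; last first.
  have [|y yY yi] := @index_enum_onto Y i; first by rewrite cY.
  have [_ yA] := YP y yY.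
  rewrite {2}eA; apply: (@joins_setU1 _ _ _ y) => //; last by rewrite class_z ?yi.
  apply: joinsS (c'P i ip); apply/subsetP => B; rewrite !in_colour_class.
  move=> /and3P []; rewrite !pairs_inE => /andP [B2 BA] BF cB.
  have zB : z \notin B by apply: contra zA'; apply: (subsetP BA).
  rewrite B2 in_set0 /c (negPf zB) (negPf BF) cB andbT /=.
  by rewrite (subset_trans BA) //; apply/subsetP.
have reach x : x \in A' -> x \notin Y -> connect (link (colour_class A set0 c p)) z x.
  by move=> xA xY; apply: connect1; rewrite /link class_z // index_enum_out ?cY.
rewrite {2}eA; apply: (@joins_root _ _ _ z) => x /setU1P [->//|xA].
have [xY|] := boolP (x \in Y); last exact: reach.
have [xw _] := YP x xY.
apply: connect_trans (reach w wA' wY) (connect1 _).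
have wxF : [set w; x] \in F by apply: imset_f.
rewrite /link in_colour_class in_pairs_in inE eq_sym xw !sA'A // /c wxF.
by rewrite ifN ?eqxx // !inE negb_or; apply/andP; split; apply: contraNneq zA' => ->.
Qed.

Lemma complete_packing A F :
    F \subset pairs_in A -> #|F| <= odd #|A| * #|A|./2 ->
  exists c, forall i, i < #|A|./2 -> joins (colour_class A F c i) A.
Proof.
move=> sF; have [oA|eA] := boolP (odd #|A|); rewrite ?mul1n ?mul0n => cF.
  by apply: odd_packing => //; have := odd_double_half #|A|; rewrite oA; lia.
have -> : F = set0 by apply/eqP; rewrite -cards_eq0; lia.
case e : (#|A|./2) => [|p]; first by exists (fun=> 0).
by apply: even_packing; have := odd_double_half #|A|; rewrite (negPf eA) e.
Qed.

End CompletePacking.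

(** * Lower bound on [lambda] by stars and a packing inside [S] *)

Section LowerBound.

Variable G : sgraph.
Implicit Types (S B : {set G}).

Lemma in_nonedges (x y : G) :
  ([set x; y] \in nonedges G) = (x != y) && ~~ adj x y.
Proof. by rewrite in_setD in_edges inE cards2 andbC; case: (x != y). Qed.

Lemma adj_notin_nonedges (x y : G) :
  x != y -> [set x; y] \notin nonedges G -> [set x; y] \in edges G.
Proof. by move=> xy; rewrite in_nonedges xy negbK in_edges. Qed.

(* Each vertex v outside S is the centre of a star spanning S; a missing edge vs
   of that star is replaced by an edge from s to a vertex of S on which no edge
   is missing, chosen differently for different v. The replacements take at most
   as many edges from S as there are missing edges outside S. *)
Lemma lambda_ge S :
    1 < #|S| -> #|nonedges G| <= odd #|S| * #|S|./2 ->
  #|G| - uphalf #|S| <= lambda S.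
Proof.
set N := nonedges G => S_gt1 cN.
have sNP : N \subset pairs G by apply: subsetDl.
pose U := S :\: cover N.
pose missing s := [set v in ~: S | [set v; s] \in N].
have missingE s v : (v \in missing s) = (v \notin S) && ([set v; s] \in N).
  by rewrite inE in_setC.
(* [missing s] and [S :&: cover N] are disjoint parts of [cover N], which has at most
   [2 * #|N| <= #|S|] elements. *)
have cU s : #|missing s| <= #|U|.
  have : #|missing s| + #|S :&: cover N| <= #|cover N|.
    rewrite -(cardsID S (cover N)) addnC setIC leq_add //.
    apply/subset_leq_card/subsetP => v; rewrite missingE in_setD => /andP [-> vs].
    by apply: in_cover vs _; rewrite set21.
  have := card_cover_pairs sNP; have : 2 * #|N| <= #|S|.
    by move: cN; case: (odd _); lia.
  by rewrite /U cardsD; lia.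
(* The i-th vertex of [missing s] is sent to the i-th vertex of [U]; by [cU] the default is not
   reached there. *)
pose f v s := nth s (enum U) (index v (enum (missing s))).
have ltf v s : v \in missing s -> index v (enum (missing s)) < size (enum U).
  by move=> vs; rewrite -cardE (leq_trans _ (cU s)) // cardE index_mem mem_enum.
have fU v s : v \in missing s -> f v s \in U.
  by move=> vs; rewrite -mem_enum mem_nth ?ltf.
have f_inj s : {in missing s &, injective (f^~ s)}.
  move=> u v us vs /eqP; rewrite nth_uniq ?ltf ?enum_uniq // => /eqP.
  by apply: (index_inj s); rewrite mem_enum.
have UP x : x \in U -> x \in S /\ x \notin cover N by rewrite inE => /andP [].
(* For [v] outside [S], only the end [s] of a borrowed edge is covered by [N]; so the edge
   determines [s], and then [v] by [f_inj]. *)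
pose borrow v B := [exists s in S, ([set v; s] \in N) && (B == [set s; f v s])].
have borrowP v B : v \notin S -> borrow v B ->
    exists s, [/\ s \in S, s \in cover N, v \in missing s & B = [set s; f v s]].
  move=> vS /exists_inP [s sS /andP [vs /eqP ->]]; exists s; split=> //.
    by apply: in_cover vs _; rewrite set22.
  by rewrite missingE vS.
have borrowS v B : v \notin S -> borrow v B -> B \in pairs_in S.
  move=> vS /(borrowP _ _ vS) [s [sS sN /fU/UP [fS fN] ->]].
  by rewrite in_pairs_in sS fS !andbT; apply: contraNneq fN => <-.
pose F := [set B in N | B \subset S] :|: [set B | [exists v in ~: S, borrow v B]].
have sF : F \subset pairs_in S.
  apply/subsetP => B /setUP [/setIdP [BN BS]|].
    by rewrite pairs_inE BS andbT; move/(subsetP sNP): BN; rewrite inE.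
  by rewrite inE => /exists_inP [v]; rewrite inE => vS /(borrowS _ _ vS).
have cF : #|F| <= #|N|.
  rewrite -(cardsID [set B : {set G} | B \subset S] N).
  apply: leq_trans (leq_card_setU _ _).1 (leq_add _ _).
    by apply/subset_leq_card/subsetP => B; rewrite !inE.
  (* Each missing edge between [S] and its complement causes at most one borrowing. *)
  pose P := [set p : G * G | [&& p.1 \notin S, p.2 \in S & [set p.1; p.2] \in N]].
  apply: (@leq_trans #|P|).
    apply: leq_trans (leq_imset_card (fun p => [set p.2; f p.1 p.2]) P).
    apply/subset_leq_card/subsetP => B; rewrite inE => /exists_inP [v].
    rewrite inE => vS /exists_inP [s sS /andP [vs /eqP ->]].
    by apply/imsetP; exists (v, s); rewrite // inE vS sS.
  rewrite -(card_in_imset (f := fun p : G * G => [set p.1; p.2])).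
    apply/subset_leq_card/subsetP => _ /imsetP [[v s] vsP ->].
    move: vsP; rewrite inE /= => /and3P [vS sS vs]; rewrite in_setD vs andbT inE.
    by apply: contra vS => /subsetP; apply; rewrite set21.
  move=> [v s] [v' s']; rewrite !inE /= => /and3P [vS sS _] /and3P [v'S s'S _] e.
  have vv' : v = v'.
    have := set21 v s; rewrite e inE => /orP [] /set1P // vs'.
    by rewrite vs' s'S in vS.
  by rewrite vv' in e *; rewrite (pair_inj e).
have [c' c'P] := complete_packing sF (leq_trans cF cN).
(* The first [#|~: S|] colours belong to the stars, the later ones to the packing inside [S]. An
   edge with both ends outside [S] goes to its first owner, but no star relies on it. *)
pose owns B v := (v \in B) || borrow v B.
pose c B := if has (owns B) (enum (~: S)) then find (owns B) (enum (~: S))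
            else #|~: S| + c' B.
have c_own B v : v \notin S -> {in ~: S, owns B =1 pred1 v} ->
    c B = index v (enum (~: S)).
  move=> vS Bv; rewrite /c ifT.
    by apply: eq_in_find => u; rewrite mem_enum => /Bv.
  by apply/hasP; exists v; rewrite ?mem_enum ?Bv ?inE.
have -> : #|G| - uphalf #|S| = #|~: S| + #|S|./2.
  by rewrite [#|~: S|]cardsCs setCK; have := max_card S; lia.
apply: (@colour_packing _ _ _ c) => // i im.
have [iR|Ri] := ltnP i #|~: S|; last first.
  have im' : i - #|~: S| < #|S|./2 by rewrite ltn_subLR.
  apply: joinsS (c'P _ im'); apply/subsetP => B; rewrite in_colour_class.
  case/and3P => BS BF /eqP cB.
  have /andP [B2 sBS] : (#|B| == 2) && (B \subset S) by rewrite -pairs_inE.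
  have BE : B \in edges G.
    apply: contraR BF => BE; rewrite inE; apply/orP; left.
    by rewrite !inE BE B2 sBS.
  rewrite inE BE /c ifN /= ?cB ?subnKC //.
  apply/hasP => -[v]; rewrite mem_enum inE => vS /orP [vB|vB].
    by rewrite (subsetP sBS) in vS.
  case/negP: BF; rewrite !inE; apply/orP; right; apply/exists_inP.
  by exists v; rewrite ?inE.
have [v vR <-] := index_enum_onto iR; have vS : v \notin S by rewrite -in_setC.
set E := [set _ in _ | _].
have neqv x : x \in S -> v != x by move=> xS; apply: contraNneq vS => ->.
have spoke x : x \in S -> [set v; x] \notin N -> connect (link E) v x.
  move=> xS vx; apply: connect1; rewrite /link inE adj_notin_nonedges ?neqv //=.
  apply/eqP/c_own => // u; rewrite inE => uS; apply/orP/eqP => [[]|->].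
  - by rewrite !inE => /orP [/eqP //|/eqP ux]; rewrite ux xS in uS.
  - move/(borrowS _ _ uS); rewrite in_pairs_in => /and3P [_ vS' _].
    by rewrite vS' in vS.
  - by left; rewrite set21.
apply: (@joins_root _ _ _ v) => s sS.
have [vs|] := boolP ([set v; s] \in N); last exact: spoke.
have vms : v \in missing s by rewrite missingE vS.
have sN : s \in cover N by apply: in_cover vs _; rewrite set22.
have [fS fN] := UP _ (fU _ _ vms).
apply: connect_trans (spoke _ fS _) _.
  by apply: contra fN => vf; apply: in_cover vf _; rewrite set22.
have sNf : s != f v s by apply: contraNneq fN => <-.
apply: connect1; rewrite link_sym /link inE adj_notin_nonedges //=; last first.
  by apply: contra fN => sf; apply: in_cover sf _; rewrite set22.
apply/eqP/c_own => // u; rewrite inE => uS; apply/orP/eqP => [[]|->].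
- by rewrite !inE => /orP [] /eqP e; rewrite e ?sS ?fS in uS.
- case/(borrowP _ _ uS) => s' [s'S s'N us' e].
  have ss' : s = s'.
    have := set21 s (f v s); rewrite e !inE => /orP [/eqP //|/eqP sf].
    by have [_] := UP _ (fU _ _ us'); rewrite -sf sN.
  by rewrite -ss' in e us'; apply: (f_inj s) => //; rewrite (pair_inj e).
- by right; apply/exists_inP; exists s; rewrite // vs eqxx.
Qed.

(** * Equality in terms of missing edges, and up to isomorphism *)

Lemma lambda_k_eq k :
    1 < k <= #|G| ->
  lambda_k G k = #|G| - uphalf k <-> #|nonedges G| <= odd k * k./2.
Proof.
case/andP => k_gt1 k_le; split=> [lk|cN]; last first.
  have [S Sk ->] := lambda_k_min k_le.
  have S_gt1 : 1 < #|S| by rewrite Sk.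
  rewrite -Sk in cN *; apply/eqP; rewrite eqn_leq lambda_ge // andbT.
  by case: (lambda_bound S_gt1).
(* Out of too many missing edges, [(odd k * k./2).+1] are selected. As this is at most [k], one end
   of each fits into a [k]-set, which then meets more missing edges than [lambda_bound] permits. *)
rewrite leqNgt; apply/negP => h_lt.
have [||N' [_ sN' cN']] :=
  exists_subset_between (A := set0) (B := nonedges G) (m := (odd k * k./2).+1).
- exact: sub0set.
- by rewrite cards0.
have /card_gt0P [x0 _] : 0 < #|G| by lia.
pose pick_end (B : {set G}) := odflt x0 [pick x in B].
have pickP B : B \in N' -> pick_end B \in B.
  move/(subsetP sN'); rewrite /pick_end !inE => /andP [_ /cards2P [x [y [_ ->]]]].
  by case: pickP => // /(_ x); rewrite set21.
have [||S [S0S _ Sk]] :=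
  exists_subset_between (A := pick_end @: N') (B := setT) (m := k).
- exact: subsetT.
- rewrite cardsT k_le andbT (leq_trans (leq_imset_card _ _)) // cN'.
  by case: (odd k); lia.
have S_gt1 : 1 < #|S| by rewrite Sk.
have [le_lS bound] := lambda_bound S_gt1.
have touched : #|touching S (nonedges G)| <= odd k * k./2.
  rewrite -Sk; apply: bound; apply/eqP; rewrite eqn_leq le_lS /= Sk -lk.
  exact: lambda_k_le.
move: touched; apply/negP; rewrite -ltnNge -cN'.
apply/subset_leq_card/subsetP => B BN'; rewrite inE (subsetP sN') //=.
apply/pred0Pn; exists (pick_end B); rewrite /= pickP //=.
exact/(subsetP S0S)/imset_f.
Qed.

Lemma iso_complete : iso G (complete #|G|) <-> nonedges G = set0.
Proof.
split=> [[f /bij_inj f_inj fP]|N0].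
  apply/setP => B; rewrite in_set0; apply/negP => BN.
  have := subsetP (subsetDl _ _) B BN; rewrite inE => /cards2P [x [y [xy eB]]].
  by move: BN; rewrite eB in_nonedges xy -fP /= /complete_adj (inj_eq f_inj) xy.
exists enum_rank; first exact: enum_rank_bij.
move=> x y; rewrite /= /complete_adj (inj_eq enum_rank_inj).
have := in_set0 [set x; y]; rewrite -N0 in_nonedges.
by have [->|xy] := eqVneq x y; rewrite ?adj_irrefl //= => /negbFE ->.
Qed.

(** An isomorphism maps the missing edges of [G] injectively into [M]; conversely their image under
    a numbering of the vertices serves as [M]. *)
Lemma iso_del_edges m :
  (exists M : {set {set complete #|G|}},
     [/\ M \subset edges (complete #|G|), #|M| <= m & iso G (del_edges M)])
  <-> #|nonedges G| <= m.
Proof.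
split=> [[M [_ cM [f /bij_inj f_inj fP]]]|cN].
  rewrite -(card_imset (mem (nonedges G)) (imset_inj f_inj)).
  apply: leq_trans cM; apply/subset_leq_card/subsetP => _ /imsetP [B BN ->].
  have := subsetP (subsetDl _ _) B BN; rewrite inE => /cards2P [x [y [xy eB]]].
  move: BN; rewrite eB in_nonedges xy -fP /= /del_adj /= /complete_adj.
  by rewrite (inj_eq f_inj) xy /= negbK imsetU1 imset_set1.
pose r : G -> complete #|G| := enum_rank.
have r_inj : injective r by exact: enum_rank_inj.
exists [set r @: (B : {set G}) | B in nonedges G]; split.
- apply/subsetP => _ /imsetP [B BN ->].
  have := subsetP (subsetDl _ _) B BN; rewrite inE => /cards2P [x [y [xy ->]]].
  by rewrite imsetU1 imset_set1 in_edges /= /complete_adj (inj_eq r_inj).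
- exact: leq_trans (leq_imset_card _ _) cN.
exists r; first exact: enum_rank_bij.
move=> x y; rewrite /= /del_adj /= /complete_adj (inj_eq r_inj).
have -> : [set r x; r y] = r @: [set x; y] by rewrite imsetU1 imset_set1.
rewrite mem_imset; last exact: imset_inj.
by rewrite in_nonedges; have [->|] := eqVneq x y; rewrite ?adj_irrefl //= negbK.
Qed.

End LowerBound.

Theorem theorem5 (G : sgraph) (n k : nat) :
  connected G -> #|G| = n -> 3 <= k -> k <= n ->
  (lambda_k G k = n - uphalf k <->
   ((~~ odd k -> iso G (complete n)) /\
    (odd k -> exists M : {set {set complete n}},
       [/\ M \subset edges (complete n), #|M| <= (k - 1) %/ 2
         & iso G (del_edges M)]))).
Proof.
move=> _ <- k_ge3 k_le; rewrite lambda_k_eq ?k_le ?andbT; last by lia.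
have -> : (k - 1) %/ 2 = k.-1./2 by rewrite subn1 divn2.
(* Both isomorphism conditions now concern [nonedges G] alone: it is empty, or has at most [k.-1./2]
   elements. *)
rewrite iso_del_edges iso_complete; case: (boolP (odd k)) => odd_k.
  have -> : k.-1./2 = k./2.
    by case: k odd_k {k_ge3 k_le} => //= k /negbTE ek; rewrite uphalf_half ek.
  by rewrite mul1n; split=> [cN|[_]]; [split | apply].
rewrite mul0n leqn0 cards_eq0; split=> [/eqP N0|[/(_ isT) -> //]].
by split.
Qed.
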